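(* Let $G$ be a $\tau$-group of nilpotency class $c$ such that $\Gamma_c(G)$ has rank at least $2$. Then no Nickel embedding of $G$ into a unitriangular group $UT_d(\mathbb{Z})$ has undistorted image.
   Context: A $\tau$-group is a finitely generated torsion-free non-abelian nilpotent group; $\Gamma_1(G)=G$, $\Gamma_{i+1}(G)=[\Gamma_i(G),G]$, $c$ is least with $\Gamma_{c+1}(G)=1$, and the rank of the free abelian group $\Gamma_c(G)$ is its number of free generators. Nickel embedding: take a Mal'cev basis $(x_1,\dots,x_r)$ of $G$ associated with a refinement, with infinite cyclic factors, of the series of isolators of the lower central series, so every $g\in G$ is uniquely $x_1^{a_1}\cdots x_r^{a_r}$. Let $t_i:G\to\mathbb{Z}$, $x_1^{a_1}\cdots x_r^{a_r}\mapsto a_i$, viewed in $(\mathbb{Q}G)^*$, on which $G$ acts by $f^g(h)=f(hg^{-1})$. The $G$-submodule $M$ generated by $t_1,\dots,t_r$ is finite-dimensional and faithful; an ordered $\mathbb{Q}$-basis of $M$ for which all matrices are upper unitriangular integer matrices gives an embedding $G\to UT_d(\mathbb{Z})$, $d=\dim M$. The image $H$ is undistorted in $K=UT_d(\mathbb{Z})$ if $\Delta_H^K(n)=\max\{dist_H(1,h): h\in H, dist_K(1,h)\le n\}$ (word metrics) satisfies $\Delta_H^K(n)\le Cn$ for a constant $C$. *)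

(* Defs.v *)
From HB Require Import structures.
From mathcomp Require Import all_boot all_order all_algebra.
From mathcomp Require Import monoid.
Set Implicit Arguments. Unset Strict Implicit. Unset Printing Implicit Defensive.
Import Order.TTheory GRing.Theory Num.Theory.

Definition unitriangular (d : nat) (A : 'M[int]_d) : Prop :=
  forall k l : 'I_d, ((l < k)%N -> A k l = 0%R) /\ A k k = 1%R.

Section GroupNotions.
Variable G : groupType.
Local Open Scope group_scope.

Definition expgz (x : G) (z : int) : G :=
  match z with Posz n => x ^+ n | Negz n => (x ^+ n.+1)^-1 end.

Inductive gen (S : G -> Prop) : G -> Prop :=
| gen_in g : S g -> gen S g
| gen_one : gen S 1
| gen_mul g h : gen S g -> gen S h -> gen S (g * h)
| gen_inv g : gen S g -> gen S g^-1.

Definition trivial_sub (P : G -> Prop) : Prop := forall g, P g -> g = 1.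

(* lcs k = Gamma_{k+1}(G):  Gamma_1 = G, Gamma_{i+1} = [Gamma_i, G] *)
Fixpoint lcs (k : nat) : G -> Prop :=
  match k with
  | 0 => fun _ => True
  | k'.+1 => gen (fun z => exists x y, lcs k' x /\ z = [~ x, y])
  end.
Definition Gamma (i : nat) : G -> Prop := lcs i.-1.

Definition fin_generated : Prop :=
  exists S : seq G, forall g, gen (fun s => s \in S) g.
Definition torsion_free : Prop := forall (g : G) n, g ^+ n.+1 = 1 -> g = 1.
Definition nilpotent : Prop := exists c, trivial_sub (Gamma c.+1).
Definition non_abelian : Prop := exists x y : G, x * y <> y * x.

Definition tau_group : Prop :=
  [/\ fin_generated, torsion_free, nilpotent & non_abelian].

Definition nil_class (c : nat) : Prop :=
  trivial_sub (Gamma c.+1) /\ forall c', trivial_sub (Gamma c'.+1) -> (c <= c')%N.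

Fixpoint nf (xs : seq G) (a : seq int) : G :=
  match xs, a with
  | x :: xs', z :: a' => expgz x z * nf xs' a'
  | _, _ => 1
  end.

Definition free_abelian_of_rank (P : G -> Prop) (r : nat) : Prop :=
  exists xs : seq G, size xs = r /\ (forall x, x \in xs -> P x) /\
    (forall g, P g -> exists! a : seq int, size a = r /\ g = nf xs a) /\
    (forall a, size a = r -> P (nf xs a)).

Definition isolator (P : G -> Prop) : G -> Prop :=
  fun g => exists n, P (g ^+ n.+1).

(* G_i = < x_i, ..., x_r >  (0-indexed: malcev_sub x i = <x_(i), ..., x_(r-1)>) *)
Definition malcev_sub (x : seq G) (i : nat) : G -> Prop :=
  gen (fun g => exists j, (i <= j < size x)%N /\ g = nth 1 x j).

(* Mal'cev basis associated with a refinement, with infinite cyclic factors,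
   of the series of isolators I(Gamma_1) >= ... >= I(Gamma_{c+1}) *)
Definition malcev_basis_lcs (c : nat) (x : seq G) : Prop :=
  [/\ (forall i, (i < size x)%N -> forall g h,
          malcev_sub x i g -> malcev_sub x i.+1 h ->
          malcev_sub x i.+1 (g^-1 * h * g)),
      (forall i, (i < size x)%N -> forall n : int,
          malcev_sub x i.+1 (expgz (nth 1 x i) n) -> n = 0%R) &
      (forall j, (1 <= j <= c.+1)%N -> exists i, (i <= size x)%N /\
          forall g, malcev_sub x i g <-> isolator (Gamma j) g)].

Definition malcev_coords (x : seq G) (t : nat -> G -> int) : Prop :=
  forall g, g = nf x (mkseq (fun i => t i g) (size x)).

(* the action of G on (QG)^* = (G -> Q):  f^g (h) = f (h g^-1) *)
Definition dual_act (g : G) (f : G -> rat) : G -> rat := fun h => f (h * g^-1).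

Local Open Scope ring_scope.

(* the G-submodule M of (QG)^* generated by t_1, ..., t_r *)
Definition in_nickel_module (x : seq G) (t : nat -> G -> int) (f : G -> rat) : Prop :=
  exists l : seq (rat * G * nat),
    all (fun p => (p.2 < size x)%N) l /\
    forall h, f h = \sum_(p <- l) p.1.1 * dual_act p.1.2 (fun k => (t p.2 k)%:~R) h.

(* b is an ordered Q-basis of M, and phi g is the matrix of the action of g on M
   in the basis b (row k = coordinates of b_k^g), which is upper unitriangular
   with integer entries for every g: phi is a Nickel embedding G -> UT_d(Z). *)
Definition nickel_embedding (x : seq G) (t : nat -> G -> int) (d : nat)
    (b : 'I_d -> G -> rat) (phi : G -> 'M[int]_d) : Prop :=
  [/\ forall k, in_nickel_module x t (b k),
      forall f, in_nickel_module x t f ->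
        exists cf : 'I_d -> rat, forall h, f h = \sum_k cf k * b k h,
      forall cf : 'I_d -> rat, (forall h, \sum_k cf k * b k h = 0) -> forall k, cf k = 0,
      forall g k h, dual_act g (b k) h = \sum_l (phi g k l)%:~R * b l h &
      forall g, unitriangular (phi g)].

End GroupNotions.

Local Open Scope ring_scope.

Definition eval_word (d : nat) (w : seq (bool * 'M[int]_d)) : 'M[int]_d :=
  foldr (fun p acc => (if p.1 then invmx p.2 else p.2) *m acc) 1%:M w.

Definition word_over (d : nat) (S : seq 'M[int]_d) (w : seq (bool * 'M[int]_d)) : bool :=
  all (fun p => p.2 \in S) w.

Definition generates (d : nat) (P : 'M[int]_d -> Prop) (S : seq 'M[int]_d) : Prop :=
  (forall s, s \in S -> P s) /\
  forall A, P A -> exists w, word_over S w /\ eval_word w = A.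

Definition word_dist_le (d : nat) (S : seq 'M[int]_d) (A : 'M[int]_d) (n : nat) : Prop :=
  exists w, [/\ word_over S w, (size w <= n)%N & eval_word w = A].

(* H undistorted in K (H <= K, word metrics for finite generating sets SH, SK):
   Delta(n) = max{dist_H(1,h) : h in H, dist_K(1,h) <= n} <= C n *)
Definition undistorted (d : nat) (H K : 'M[int]_d -> Prop) : Prop :=
  exists (SH SK : seq 'M[int]_d), generates H SH /\ generates K SK /\
    exists C : nat, forall n A, H A -> word_dist_le SK A n -> word_dist_le SH A (C * n).

Definition image_of (G : groupType) (d : nat) (phi : G -> 'M[int]_d) : 'M[int]_d -> Prop :=
  fun A => exists g, A = phi g.

(* Main.v *)
Require Import Defs.
From mathcomp Require Import all_boot all_order all_algebra.
From mathcomp Require Import monoid.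
From mathcomp Require Import zify ring.

(** If z is central in G and every coordinate t_i satisfies t_i(gz) = t_i(g) + const,
    then z - 1 maps the Nickel module into the constants, so phi(z) - 1 is a rank one
    matrix mu(z) (x) e, where e is the coordinate vector of the constant function 1
    and mu is additive in z. As Gamma_c(G) lands in Gamma_c(UT_d(Z)), such a matrix
    has at most one nonzero entry on the c-th superdiagonal, at a position that does
    not depend on z. When Gamma_c(G) has rank at least 2, some z <> 1 in Gamma_c(G)
    makes this entry vanish; then phi(z)^(m^(c+1)) has length O(m) in UT_d(Z), being
    a product of (c+1)-fold commutators of elementary matrices.

    On the other hand z^N has length at least const N^(1/c) in G: collecting a word
    of length n into Mal'cev normal form produces exponents O(n^w) on the basis
    elements of weight w, where an element has weight w if it lies in the isolator
    of Gamma_w(G) but not in that of Gamma_(w+1)(G). The two estimates contradict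
    undistortedness. *)

Set Implicit Arguments. Unset Strict Implicit. Unset Printing Implicit Defensive.
Import Order.TTheory GRing.Theory Num.Theory.

Local Ltac gsimp :=
  rewrite /commg /conjg
    ?(invgM, invgK, invg1, mulgA, mulgK, mulgVK, mulgV, mulVg, mul1g, mulg1).

(** * Normal subgroups, lower central series and isolators *)

Section Subgroups.
Variable G : groupType.
Local Open Scope group_scope.

Definition subgroup (N : G -> Prop) : Prop :=
  [/\ N 1, forall g h, N g -> N h -> N (g * h) & forall g, N g -> N g^-1].

Definition normal_subgroup (N : G -> Prop) : Prop :=
  subgroup N /\ forall g h, N g -> N (g ^ h).

Definition isolated (N : G -> Prop) : Prop :=
  forall g n, N (g ^+ n.+1) -> N g.

Lemma gen_subgroup (S : G -> Prop) : subgroup (gen S).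
Proof. by split; [exact: gen_one | exact: gen_mul | exact: gen_inv]. Qed.

Lemma gen_min (S N : G -> Prop) :
  subgroup N -> (forall g, S g -> N g) -> forall g, gen S g -> N g.
Proof.
move=> [N1 NM NV] SN g; elim=> {g} [g /SN//|//|g h _ Ng _ Nh|g _ Ng].
- exact: NM.
- exact: NV.
Qed.

Lemma subgroupX N g n : subgroup N -> N g -> N (g ^+ n).
Proof.
move=> [N1 NM _] Ng; elim: n => [|n IHn]; first by rewrite expg0.
by rewrite expgS; apply: NM.
Qed.

Lemma subgroup_expgz N g z : subgroup N -> N g -> N (expgz g z).
Proof.
move=> sN Ng; case: z => n /=; first exact: subgroupX.
by case: (sN) => _ _; apply; apply: subgroupX.
Qed.

Lemma gen_conj (S : G -> Prop) :
  (forall g h, S g -> S (g ^ h)) -> forall g h, gen S g -> gen S (g ^ h).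
Proof.
move=> SJ g h; elim=> {g} [g Sg||g k _ Ng _ Nh|g _ Ng].
- by apply: gen_in; apply: SJ.
- by rewrite conj1g; apply: gen_one.
- by rewrite conjMg; apply: gen_mul.
- by rewrite conjVg; apply: gen_inv.
Qed.

Lemma commMgJ (x y z : G) : [~ x * y, z] = [~ x, z] ^ y * [~ y, z].
Proof. by gsimp. Qed.

Lemma commgMJ (x y z : G) : [~ x, y * z] = [~ x, z] * [~ x, y] ^ z.
Proof. by gsimp. Qed.

Lemma commVgJ (x y : G) : [~ x^-1, y] = ([~ x, y] ^ x^-1)^-1.
Proof. by gsimp. Qed.

Lemma commgVJ (x y : G) : [~ x, y^-1] = ([~ x, y] ^ y^-1)^-1.
Proof. by gsimp. Qed.

Lemma Hall_Witt (x y z : G) :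
  [~ x, y^-1, z] ^ y * [~ y, z^-1, x] ^ z * [~ z, x^-1, y] ^ x = 1.
Proof. by gsimp. Qed.

Lemma normal_subgroup_comml N x y : normal_subgroup N -> N x -> N [~ x, y].
Proof. by move=> [[_ NM NV] NJ] Nx; rewrite commgEl; apply: NM; [apply: NV|apply: NJ]. Qed.

Lemma lcs_normal k : normal_subgroup (@lcs G k).
Proof.
elim: k => [|k [_ IHk]]; first by split=> //; split.
split; first exact: gen_subgroup.
apply: gen_conj => g h [x [y [xk ->]]].
by exists (x ^ h), (y ^ h); split; [exact: IHk | rewrite conjRg].
Qed.

Lemma lcs_comm k x y : @lcs G k x -> @lcs G k.+1 [~ x, y].
Proof. by move=> xk; apply: gen_in; exists x, y. Qed.

Lemma lcsS k x : @lcs G k.+1 x -> @lcs G k x.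
Proof.
apply: gen_min; first by case: (lcs_normal k).
by move=> g [u [v [uk ->]]]; apply: normal_subgroup_comml => //; apply: lcs_normal.
Qed.

Lemma lcs_le j k x : j <= k -> @lcs G k x -> @lcs G j x.
Proof. by move/subnK <-; elim: (k - j) => [//|n IHn] /lcsS. Qed.

(* The three subgroup lemma, via the Hall-Witt identity. *)
Lemma lcs_commM a b x y : @lcs G a x -> @lcs G b y -> @lcs G (a + b).+1 [~ x, y].
Proof.
elim: b a x y => [|b IHb] a x y xa; first by rewrite addn0 => _; apply: lcs_comm.
have [[N1 NM NV] NJ] := lcs_normal (a + b.+1).+1.
elim=> {y} [y [u [v [ub ->]]]||g h _ IHg _ IHh|g _ IHg].
- have [[_ _ aV] _] := lcs_normal a; have [[_ _ bV] _] := lcs_normal b.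
  have xVa := aV _ xa.
  have NJV (g h : G) : @lcs G (a + b.+1).+1 (g ^ h) -> lcs (a + b.+1).+1 g.
    by move=> Ngh; rewrite -(conjgK h g); apply: NJ.
  (* [H1] and [H2] place two factors of the Hall-Witt identity in the target term; the third factor,
     a conjugate of [[~ u, v, x^-1]], must then lie there too. Since [[~ v^-1, x]] is one step
     deeper than [x], the induction hypothesis on [b] is used at [a.+1]. *)
  have H1 : @lcs G (a + b.+1).+1 [~ v^-1, x, u].
    rewrite addnS -addSn; apply: IHb => //.
    by rewrite -invgR; case: (lcs_normal a.+1) => -[_ _ V] _; apply: V; apply: lcs_comm.
  have H2 : @lcs G (a + b.+1).+1 [~ x^-1, u^-1, v^-1].
    by rewrite addnS; apply: lcs_comm; apply: IHb => //; apply: bV.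
  have := Hall_Witt u v^-1 x^-1; rewrite !invgK => HW.
  have H3 : @lcs G (a + b.+1).+1 ([~ u, v, x^-1] ^ v^-1).
    have -> : [~ u, v, x^-1] ^ v^-1 =
       ([~ v^-1, x, u] ^ x^-1 * [~ x^-1, u^-1, v^-1] ^ u)^-1.
      by apply/eqP; rewrite -mulg_eq1 mulgA; apply/eqP.
    by apply: NV; apply: NM; apply: NJ.
  rewrite -invgR; apply: (NV); rewrite -[x]invgK commgVJ; apply: NV; apply: NJ; apply: NJV H3.
- by rewrite commg1.
- by rewrite commgMJ; apply: NM => //; apply: NJ.
- by rewrite commgVJ; apply: NV; apply: NJ.
Qed.

End Subgroups.

(** * Isolators in nilpotent groups and their commutators *)

Section Isolators.
Variable G : groupType.
Local Open Scope group_scope.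

(* Preimages in G of the upper central series of G/N. *)
Fixpoint ucs_mod (N : G -> Prop) (j : nat) : G -> Prop :=
  if j is j'.+1 then fun u => forall y, ucs_mod N j' [~ u, y] else N.

Lemma ucs_mod_normal N j : normal_subgroup N -> normal_subgroup (ucs_mod N j).
Proof.
move=> nN; elim: j => [//|j [[Z1 ZM ZV] ZJ]]; split; [split|] => /=.
- by move=> y; rewrite comm1g.
- by move=> g h Zg Zh y; rewrite commMgJ; apply: ZM => //; apply: ZJ.
- by move=> g Zg y; rewrite commVgJ; apply: ZV; apply: ZJ.
- move=> g h Zg y; rewrite -(conjgKV h y) -conjRg; apply: ZJ; exact: Zg.
Qed.

Lemma ucs_mod_ge N j g : normal_subgroup N -> N g -> ucs_mod N j g.
Proof.
move=> nN Ng; elim: j => [//|j IHj] y /=.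
by apply: normal_subgroup_comml => //; apply: ucs_mod_normal.
Qed.

Lemma expgn_central_mod N (x u : G) n : normal_subgroup N ->
  (forall y, N [~ u, y]) -> N ((x ^+ n * u ^+ n)^-1 * (x * u) ^+ n).
Proof.
move=> nN cu; have [[N1 NM NV] NJ] := nN.
elim: n => [|n IHn]; first by rewrite !expg0 !mulg1 invg1.
have -> : (x ^+ n.+1 * u ^+ n.+1)^-1 * (x * u) ^+ n.+1 =
  ([~ u ^+ n, x] * ((x ^+ n * u ^+ n)^-1 * (x * u) ^+ n) ^ x) ^ u.
  by rewrite !expgSr; gsimp.
apply: (NJ); apply: (NM); last exact: NJ.
exact: (@subgroupX _ (ucs_mod N 1) u n (proj1 (ucs_mod_normal 1 nN)) cu x).
Qed.

(** The upper central factors of a torsion-free group are torsion-free. As [[~ u, y]] is central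
    modulo the next lower term, [[~ u, y] ^+ n.+1] agrees there with [[~ u ^+ n.+1, y]], and
    induction applies to [[~ u, y]]. *)
Lemma ucs_mod_isolated N j u n : normal_subgroup N -> isolated N ->
  ucs_mod N j.+1 u -> ucs_mod N j (u ^+ n.+1) -> ucs_mod N j u.
Proof.
move=> nN iN; elim: j u => [|j IHj] u; first by move=> _ /iN.
move=> Zu Zun y; apply: IHj; first exact: Zu.
have nZ := ucs_mod_normal j nN; have [[Z1 ZM ZV] ZJ] := nZ.
have E := expgn_central_mod u n.+1 nZ (Zu y).
rewrite -[X in ucs_mod _ _ X]invgK; apply: (ZV).
have -> : ([~ u, y] ^+ n.+1)^-1 = ((u ^+ n.+1 * [~ u, y] ^+ n.+1)^-1 *
   (u * [~ u, y]) ^+ n.+1) * ([~ u ^+ n.+1, y])^-1.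
  rewrite (_ : u * [~ u, y] = u ^ y); last by gsimp.
  by rewrite -conjXg; gsimp.
by apply: ZM => //; apply: ZV; apply: Zun.
Qed.

(** In a torsion-free nilpotent quotient, an element commutes with whatever its powers commute with.
    The commutator [[~ x, y]] descends the upper central series modulo [N] one term at a time, by
    [ucs_mod_isolated]. *)
Lemma isolated_commXl N c (x y : G) n : normal_subgroup N -> isolated N ->
  trivial_sub (@lcs G c) -> N [~ x ^+ n.+1, y] -> N [~ x, y].
Proof.
move=> nN iN tc Nxy.
have Zall k : forall u, lcs (c - k) u -> ucs_mod N k u.
  elim: k => [|k IHk] u; first by rewrite subn0 => /tc ->; case: nN => -[].
  have [ck|kc] := leqP c k.
    by move=> _ y'; apply: IHk; rewrite (eqP ck).
  move=> uk y'; apply: IHk.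
  by rewrite (_ : c - k = (c - k.+1).+1); [apply: lcs_comm | lia].
have : ucs_mod N c [~ x, y] by apply: Zall; rewrite subnn.
elim: c {tc Zall} => [//|j IHj] Zu; apply: IHj.
apply: (@ucs_mod_isolated N j _ n nN iN Zu).
have nZ := ucs_mod_normal j nN; have [[Z1 ZM ZV] ZJ] := nZ.
have E := expgn_central_mod x n.+1 nZ Zu.
rewrite -[X in ucs_mod _ _ X]invgK; apply: (ZV).
have -> : ([~ x, y] ^+ n.+1)^-1 = ((x ^+ n.+1 * [~ x, y] ^+ n.+1)^-1 *
   (x * [~ x, y]) ^+ n.+1) * ([~ x ^+ n.+1, y])^-1.
  rewrite (_ : x * [~ x, y] = x ^ y); last by gsimp.
  by rewrite -conjXg; gsimp.
by apply: ZM => //; apply: ZV; apply: ucs_mod_ge.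
Qed.

Definition iso_lcs (k : nat) : G -> Prop := isolator (@Gamma G k).

Lemma iso_lcs_conj k g h : iso_lcs k g -> iso_lcs k (g ^ h).
Proof.
by move=> [n gn]; exists n; rewrite -conjXg; case: (lcs_normal G k.-1) => _; apply.
Qed.

Lemma iso_lcs_isolated k : isolated (iso_lcs k).
Proof.
move=> g n [m gnm]; exists (n.+1 * m.+1).-1.
by rewrite prednK ?muln_gt0 // expgnA.
Qed.

(** Suitable powers of [x] and [y] have their commutator in the lower central series;
    [isolated_commXl] then strips the exponents one argument at a time, the commutator being
    inverted in between. *)
Lemma iso_lcs_comm c a b (x y : G) :
  trivial_sub (@lcs G c) -> 0 < a -> 0 < b -> subgroup (iso_lcs (a + b)) ->
  iso_lcs a x -> iso_lcs b y -> iso_lcs (a + b) [~ x, y].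
Proof.
move=> tc a0 b0 sN [n xn] [m ym].
have nN : normal_subgroup (iso_lcs (a + b)).
  by split=> // g h; apply: iso_lcs_conj.
have iN := @iso_lcs_isolated (a + b).
have [[N1 NM NV] NJ] := nN.
have : iso_lcs (a + b) [~ x ^+ n.+1, y ^+ m.+1].
  exists 0; rewrite expg1.
  suff -> : Gamma (a + b) [~ x ^+ n.+1, y ^+ m.+1] =
            lcs (a.-1 + b.-1).+1 [~ x ^+ n.+1, y ^+ m.+1] by apply: lcs_commM.
  by rewrite /Gamma; congr (lcs _ _); lia.
move=> /(isolated_commXl nN iN tc) /NV; rewrite invgR.
by move=> /(isolated_commXl nN iN tc) /NV; rewrite invgR.
Qed.

End Isolators.

(** * Integer powers and Mal'cev normal forms *)

Section IntegerPowers.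
Variable G : groupType.
Local Open Scope group_scope.

Lemma expgz_succ (x : G) z : expgz x (z + 1)%R = expgz x z * x.
Proof.
case: z => n; first by rewrite -PoszD addn1 /= expgSr.
case: n => [|n]; first by rewrite /= expg1 mulVg.
rewrite (_ : (Negz n.+1 + 1)%R = Negz n); last by lia.
by rewrite /= [x ^+ n.+2]expgS invgM mulgVK.
Qed.

Lemma expgzD (x : G) a b : expgz x (a + b)%R = expgz x a * expgz x b.
Proof.
elim: b => [|n IHn|n IHn]; first by rewrite addr0 /= mulg1.
  by rewrite intS [(1 + _)%R]addrC addrA !expgz_succ IHn mulgA.
apply: (@mulIg _ x); rewrite -mulgA -!expgz_succ.
by rewrite -addrA (_ : (- n.+1%:Z + 1)%R = - n%:Z)%R //; lia.
Qed.

Lemma expgzN (x : G) a : expgz x (- a)%R = (expgz x a)^-1.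
Proof. by apply/esym/mulg1_eq; rewrite -expgzD subrr. Qed.

Lemma expgzM (x : G) a b : expgz x (a * b)%R = expgz (expgz x a) b.
Proof.
elim: b => [|n IHn|n IHn]; first by rewrite mulr0.
  by rewrite intS mulrDr mulr1 !expgzD IHn.
rewrite intS opprD mulrDr mulrN1 [in LHS]expgzD expgzN IHn.
by rewrite [in RHS]expgzD expgzN.
Qed.

End IntegerPowers.

Section MalcevBasis.
Variables (G : groupType) (x : seq G).
Local Open Scope group_scope.
Local Notation r := (size x).

Definition infinite_cyclic_factors : Prop :=
  forall i, i < r -> forall n : int,
    malcev_sub x i.+1 (expgz (nth 1 x i) n) -> n = 0%R.

Lemma malcev_sub_subgroup i : subgroup (malcev_sub x i).
Proof. exact: gen_subgroup. Qed.

Lemma malcev_sub_nth i k : i <= k < r -> malcev_sub x i (nth 1 x k).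
Proof. by move=> ik; apply: gen_in; exists k. Qed.

Lemma malcev_sub_le i j g : i <= j -> malcev_sub x j g -> malcev_sub x i g.
Proof.
move=> ij; apply: gen_min; first exact: malcev_sub_subgroup.
move=> h [k [/andP[jk kr] ->]]; apply: malcev_sub_nth.
by rewrite (leq_trans ij jk).
Qed.

Lemma malcev_sub_nf i a : malcev_sub x i (nf (drop i x) a).
Proof.
elim: a i => [|z a IHa] i; first by case: (drop i x) => *; apply: gen_one.
have [ir|ri] := ltnP i r; last by rewrite drop_oversize //; apply: gen_one.
rewrite (drop_nth 1 ir) /=; apply: gen_mul.
  apply: subgroup_expgz; first exact: malcev_sub_subgroup.
  by apply: malcev_sub_nth; rewrite leqnn.
by apply: malcev_sub_le (IHa i.+1).
Qed.

(** The quotient of the two leading powers lies in the next tail, so infinite cyclicity of the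
    factor equates the leading exponents, which then cancel. *)
Lemma nf_inj_drop i a b : infinite_cyclic_factors ->
  size a = r - i -> size b = r - i ->
  nf (drop i x) a = nf (drop i x) b -> a = b.
Proof.
move=> icf; elim: a b i => [|z a IHa] [|y b] i //=; try by move=> sa sb; exfalso; lia.
move=> sa sb; have ir : i < r by lia.
rewrite (drop_nth 1 ir) /= => E.
have yz : (- y + z)%R = 0%R.
  apply: (icf i ir); rewrite expgzD expgzN.
  have -> : (expgz (nth 1 x i) y)^-1 * expgz (nth 1 x i) z =
     nf (drop i.+1 x) b * (nf (drop i.+1 x) a)^-1.
    by apply: (@mulIg _ (nf (drop i.+1 x) a)); rewrite mulgVK -mulgA E mulKg.
  by apply: gen_mul; [|apply: gen_inv]; apply: malcev_sub_nf.
have {yz} zy : z = y by lia.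
move: E; rewrite zy => /mulgI E; congr (_ :: _).
by apply: (IHa b i.+1) => //; lia.
Qed.

Lemma nf_inj a b : infinite_cyclic_factors ->
  size a = r -> size b = r -> nf x a = nf x b -> a = b.
Proof.
move=> icf sa sb; rewrite -[in X in X -> _](drop0 x).
by apply: nf_inj_drop; rewrite ?subn0.
Qed.

Definition letter (l : bool * nat) : G :=
  if l.1 then (nth 1 x l.2)^-1 else nth 1 x l.2.

Definition wval (W : seq (bool * nat)) : G := \prod_(l <- W) letter l.

Definition wrange (i : nat) (W : seq (bool * nat)) : bool :=
  all (fun l => i <= l.2 < r) W.

Lemma wval_cat W V : wval (W ++ V) = wval W * wval V.
Proof. exact: big_cat. Qed.

Lemma wrange_le i j W : i <= j -> wrange j W -> wrange i W.
Proof. by move=> ij; apply: sub_all => l /andP[jl ->]; rewrite (leq_trans ij jl). Qed.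

Lemma wval_inv i W : wrange i W -> exists2 V, wrange i V & wval V = (wval W)^-1.
Proof.
elim: W => [|[b k] W IHW] /=; first by exists [::]; rewrite // /wval big_nil invg1.
move=> /andP[ik /IHW[V Vi EV]]; exists (V ++ [:: (~~ b, k)]).
  by rewrite /wrange all_cat [all _ V]Vi /= ik.
rewrite wval_cat EV /wval big_seq1 big_cons invgM; congr (_ * _).
by case: b; rewrite /letter //= invgK.
Qed.

Lemma malcev_sub_word i g : malcev_sub x i g -> exists2 W, wrange i W & wval W = g.
Proof.
elim=> {g} [g [k [ik ->]]||g h _ [W Wi <-] _ [V Vi <-]|g _ [W Wi <-]].
- by exists [:: (false, k)]; rewrite /wrange /wval ?big_seq1 //= ik.
- by exists [::]; rewrite /wval ?big_nil.
- by exists (W ++ V); rewrite ?wval_cat // /wrange all_cat [all _ W]Wi.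
- exact: wval_inv.
Qed.

End MalcevBasis.

(** * Polynomial bounds on Mal'cev coordinates *)

Lemma uniform_bound (P : nat -> nat -> Prop) n :
  (forall k K K', K <= K' -> P k K -> P k K') ->
  (forall k, k < n -> exists K, P k K) -> exists K, forall k, k < n -> P k K.
Proof.
move=> mono; elim: n => [|n IHn] H; first by exists 0.
have [K HK] := IHn (fun k kn => H k (ltnW kn)).
have [K' HK'] := H n (ltnSn n).
exists (K + K') => k; rewrite ltnS leq_eqVlt => /orP[/eqP->|kn].
  by apply: mono HK'; rewrite leq_addl.
by apply: mono (HK k kn); rewrite leq_addr.
Qed.

(** Over a finite range the function is built by induction, without an axiom of choice. *)
Lemma finite_choice (P : nat -> nat -> Prop) n :
  (forall k, k < n -> exists i, P k i) ->
  exists f : nat -> nat, forall k, k < n -> P k (f k).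
Proof.
elim: n => [|n IHn] H; first by exists id.
have [f Hf] := IHn (fun k kn => H k (ltnW kn)).
have [i Hi] := H n (ltnSn n).
exists (fun k => if k == n then i else f k) => k.
rewrite ltnS leq_eqVlt; case: eqP => [-> //|_ /= kn]; exact: Hf.
Qed.

(** * Collection into normal form over an abstract filtration [I] with additive commutator
    weights *)

Section CollectionProcess.
Variables (G : groupType) (x : seq G) (c : nat) (wt : nat -> nat).
Variable I : nat -> G -> Prop.
Local Open Scope group_scope.
Local Notation r := (size x).

Hypothesis malcev_normal : forall i, i < r -> forall g h,
  malcev_sub x i g -> malcev_sub x i.+1 h -> malcev_sub x i.+1 (g^-1 * h * g).
Hypothesis wt_gt0 : forall k, k < r -> 0 < wt k.
Hypothesis wt_le : forall k, k < r -> wt k <= c.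
Hypothesis I_nth : forall k, k < r -> I (wt k) (nth 1 x k).
Hypothesis I_subgroup : forall s, 0 < s -> subgroup (I s).
Hypothesis I_comm : forall a b g h, 0 < a -> 0 < b ->
  I a g -> I b h -> I (a + b) [~ g, h].
Hypothesis I_trivial : forall s g, c < s -> I s g -> g = 1.
Hypothesis I_word : forall i s g, 0 < s <= c -> malcev_sub x i g -> I s g ->
  exists2 W, wrange x i W & wval x W = g /\ all (fun l => s <= wt l.2) W.

(* At scale n a letter of weight w is charged n^-w; multiplying by n^c keeps
   the cost in nat. *)
Definition cost (n : nat) (W : seq (bool * nat)) : nat :=
  (\sum_(l <- W) n ^ (c - wt l.2))%N.

Definition costs (i n : nat) (g : G) (q : nat) : Prop :=
  exists2 W, wrange x i W & wval x W = g /\ cost n W <= q.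

Lemma costs1 i n : costs i n 1 0.
Proof. by exists [::]; rewrite // /wval /cost !big_nil. Qed.

Lemma costsM i n g h p q :
  costs i n g p -> costs i n h q -> costs i n (g * h) (p + q).
Proof.
move=> [W Wi [<- Wp]] [V Vi [<- Vq]]; exists (W ++ V).
  by rewrite /wrange all_cat [all _ W]Wi.
by rewrite wval_cat /cost big_cat leq_add.
Qed.

Lemma costs_le i n g p q : p <= q -> costs i n g p -> costs i n g q.
Proof. by move=> pq [W Wi [gW Wp]]; exists W; rewrite // (leq_trans Wp). Qed.

(** One word for [g] serves every scale [n]: its length is fixed and each of its letters has weight
    at least [s]. *)
Lemma costs_filtration i s g : 0 < s <= c -> malcev_sub x i g -> I s g ->
  exists K, forall n, 0 < n -> costs i n g (K * n ^ (c - s)).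
Proof.
move=> sc gi gs; have [W Wi [gW Ws]] := I_word sc gi gs.
exists (size W) => n n0; exists W => //; split=> //.
elim: W Ws {Wi gW} => [|l W IHW] /=; first by rewrite /cost big_nil.
move=> /andP[sl /IHW]; rewrite /cost big_cons mulSn; apply: leq_add.
by rewrite leq_pexp2l //; lia.
Qed.

(* With z = [y, u] one has y^(u^e) = y z z^u ... z^(u^(e-1)), and z is deeper
   in the filtration than y: induct on the depth. *)
Lemma costs_conj i u s y C : i < r -> malcev_sub x i u -> I (wt i) u -> 0 < s ->
  malcev_sub x i.+1 y -> I s y ->
  exists K, forall n e, 0 < n -> e <= C * n ^ wt i ->
    costs i.+1 n (y ^ (u ^+ e)) (K * n ^ (c - s)).
Proof.
move=> ir ui uI; have wi := wt_gt0 ir.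
(* Fuel for the induction: [s] grows by [wt i], hence by at least 1, at each level, and [I] is
   trivial beyond [c]. *)
have [f] : exists f, c < s + f by exists c.+1; lia.
elim: f s y => [|f IHf] s y csf s0 yi ys.
  exists 0 => n e _ _; rewrite (I_trivial _ ys) ?conj1g; last by lia.
  exact: costs1.
have [cs|sc] := ltnP c s.
  exists 0 => n e _ _; rewrite (I_trivial _ ys) ?conj1g //.
  exact: costs1.
have ssc : 0 < s <= c by rewrite s0.
have [K0 HK0] := costs_filtration ssc yi ys.
have zI : I (s + wt i) [~ y, u] by apply: I_comm.
have zi : malcev_sub x i.+1 [~ y, u].
  rewrite commgEl conjgE [u^-1 * _]mulgA; apply: gen_mul; first exact: gen_inv.
  exact: malcev_normal.
have [cw|wc] := ltnP c (s + wt i).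
  exists K0 => n e n0 _; suff -> : y ^ (u ^+ e) = y by apply: HK0.
  apply/conjg_fixP/commgP/commuteX/commgP/eqP; exact: I_trivial zI.
have [||K1 HK1] := IHf _ _ _ _ zi zI; try lia.
(* [K0] pays for [y] and [K1] for each of the [e] conjugates of [[~ y, u]]; the bound on [e]
   contributes a factor [n ^ wt i], exactly what the deeper weight saves. *)
exists (K0 + C * K1)%N => n e n0 eC.
apply: (@costs_le _ _ _ (K0 * n ^ (c - s) + e * (K1 * n ^ (c - (s + wt i))))%N).
  have -> : c - s = (wt i + (c - (s + wt i)))%N by lia.
  rewrite expnD mulnDl leq_add2l; set p := (_ ^ (c - _))%N.
  rewrite (_ : C * K1 * _ = C * n ^ wt i * (K1 * p))%N; last by ring.
  by rewrite leq_mul2r eC orbT.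
elim: e eC => [|e IHe] eC; first by rewrite expg0 conjg1 addn0; apply: HK0.
rewrite expgS conjgM (_ : y ^ u = y * [~ y, u]); last first.
  by rewrite commgEl mulVKg.
rewrite conjMg mulSn addnCA addnC; apply: costsM; first by apply: IHe; lia.
by apply: HK1 => //; lia.
Qed.

Lemma letter_malcev_sub i l : i <= l.2 < r -> malcev_sub x i (letter x l).
Proof.
move=> lr; rewrite /letter; case: ifP => _; last exact: malcev_sub_nth.
by apply: gen_inv; apply: malcev_sub_nth.
Qed.

Lemma letter_filtration l : l.2 < r -> I (wt l.2) (letter x l).
Proof.
move=> lr; have [_ _ IV] := I_subgroup (wt_gt0 lr).
by rewrite /letter; case: ifP => _; [apply: IV|]; apply: I_nth.
Qed.

Lemma costs_conj_letter i C : i < r ->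
  exists K, forall l, i < l.2 < r -> forall n (e : int), 0 < n ->
    (`|e| <= C * n ^ wt i)%N ->
    costs i.+1 n (letter x l ^ expgz (nth 1 x i) e) (K * n ^ (c - wt l.2)).
Proof.
move=> ir.
pose P k K := i < k -> forall (b : bool) n (e : int), 0 < n ->
    (`|e| <= C * n ^ wt i)%N ->
    costs i.+1 n (letter x (b, k) ^ expgz (nth 1 x i) e) (K * n ^ (c - wt k)).
have [|k kr|K HK] := @uniform_bound P r.
- move=> k K K' KK' PK ik b n e n0 eC; apply: costs_le (PK ik b n e n0 eC).
  by rewrite leq_mul2r KK' orbT.
- have [ik|ki] := ltnP i k; last by exists 0; rewrite /P ltnNge ki.
  have xi b : malcev_sub x i (letter x (b, i)) by apply: letter_malcev_sub; rewrite leqnn.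
  have xI b : I (wt i) (letter x (b, i)) by apply: (@letter_filtration (b, i)).
  have y_in b : malcev_sub x i.+1 (letter x (b, k)) by apply: letter_malcev_sub; rewrite ik.
  have yI b : I (wt k) (letter x (b, k)) by apply: (@letter_filtration (b, k)).
  have wk := wt_gt0 kr.
  (* Four constants for the sign of the conjugating power and the sign of the letter: a negative
     exponent is treated as a positive power of the inverse basis element. *)
  have [K1 H1] := costs_conj C ir (xi false) (xI false) wk (y_in false) (yI false).
  have [K2 H2] := costs_conj C ir (xi true) (xI true) wk (y_in false) (yI false).
  have [K3 H3] := costs_conj C ir (xi false) (xI false) wk (y_in true) (yI true).
  have [K4 H4] := costs_conj C ir (xi true) (xI true) wk (y_in true) (yI true).
  exists (K1 + K2 + K3 + K4)%N => _ b n e n0 eC.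
  case: b; case: e eC => e eC; rewrite /expgz -?expVgn.
  + by apply: costs_le (H3 n e n0 eC); rewrite leq_mul2r; lia.
  + by apply: costs_le (H4 n e.+1 n0 eC); rewrite leq_mul2r; lia.
  + by apply: costs_le (H1 n e n0 eC); rewrite leq_mul2r; lia.
  + by apply: costs_le (H2 n e.+1 n0 eC); rewrite leq_mul2r; lia.
by exists K => -[b k] /andP[ik kr] n e n0 eC; apply: HK.
Qed.

(** Letters of index [i] are gathered on the left, reading the word from its right end. Any other
    letter that meets the power gathered so far gets conjugated by it, and this power is small
    enough for [costs_conj_letter]. *)
Lemma collect_letter i C : i < r -> exists K, forall n W, 0 < n ->
  wrange x i W -> (count (fun l => l.2 == i) W <= C * n ^ wt i)%N ->
  exists (a : int) g, [/\ (`|a| <= count (fun l => l.2 == i) W)%N,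
    wval x W = expgz (nth 1 x i) a * g & costs i.+1 n g (K * cost n W)].
Proof.
move=> ir; have [K HK] := costs_conj_letter C ir; exists K => n W n0.
elim: W => [|l W IHW] /=.
  exists 0%R, 1; rewrite /wval /cost !big_nil mulg1 muln0; split=> //; exact: costs1.
move=> /andP[/andP[il lr] Wi] cW.
have [|a [g [aW gW gc]]] := IHW Wi; first exact: leq_trans (leq_addl _ _) cW.
rewrite /wval /cost !big_cons -/(wval x W) -/(cost n W) gW mulnDr.
case: eqP cW aW => [li|/eqP li] cW aW; last first.
  exists a, (letter x l ^ expgz (nth 1 x i) a * g); split; first exact: aW.
    by rewrite mulgA (conjgC (letter x l)) -mulgA.
  apply: costsM gc; apply: HK => //; first by rewrite lr andbT ltn_neqAle eq_sym li.
  exact: leq_trans aW cW.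
exists ((if l.1 then -1 else 1) + a)%R, g; split.
  by move: aW; move: (count _ W) => q; case: l.1; lia.
  rewrite expgzD mulgA /letter li; congr (_ * _ * _).
  by case: l.1 => /=.
by apply: costs_le gc; rewrite leq_addl.
Qed.

(** The basis elements are collected in order. The cost bound leaves room for only [C * n ^ wt i]
    letters of index [i], and the remainder costs at most [K] times as much, so constants grow only
    over a fixed number of rounds. *)
Lemma nf_bound i C : i <= r -> exists K, forall n W, 0 < n ->
  wrange x i W -> (cost n W <= C * n ^ c)%N ->
  exists a, [/\ size a = r - i, wval x W = nf (drop i x) a &
    all (fun z : int => `|z| <= K * n ^ c)%N a].
Proof.
have [m] := ubnP (r - i); elim: m i C => [//|m IHm] i C rim ir.
have [ri|{ir}ir] := leqP r i.
  exists 0 => n W n0 Wi _; exists [::]; split=> //=; first by lia.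
    rewrite drop_oversize //=; case: W Wi => [|l W]; first by rewrite /wval big_nil.
    by move=> /= /andP[]; lia.
have [K HK] := collect_letter C ir.
have [||K' HK'] := IHm i.+1 (K * C)%N; [by lia | by [] |].
exists (C + K')%N => n W n0 Wi cW.
have count_cost : (count (fun l => l.2 == i) W * n ^ (c - wt i) <= cost n W)%N.
  elim: W {Wi cW} => [|l W IHW] //=; rewrite /cost big_cons -/(cost n W) mulnDl.
  apply: leq_add => //; case: eqP => [->|_]; by rewrite ?mul1n.
have countW : (count (fun l => l.2 == i) W <= C * n ^ wt i)%N.
  rewrite -(@leq_pmul2r (n ^ (c - wt i))) ?expn_gt0 ?n0 //.
  rewrite -mulnA -expnD subnKC; last exact: wt_le.
  exact: leq_trans count_cost cW.
have [a [g [aW gW [V Vi [Vg cV]]]]] := HK n W n0 Wi countW.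
have [|b [sb gb bK]] := HK' n V n0 Vi.
  by apply: leq_trans cV _; rewrite -mulnA leq_mul2l cW orbT.
exists (a :: b); split; first by rewrite /= sb; lia.
  by rewrite gW (drop_nth 1 ir) /= -gb Vg.
rewrite /= mulnDl; apply/andP; split.
  apply: leq_trans (leq_trans aW countW) _; apply: leq_trans (leq_addr _ _).
  by rewrite leq_mul2l leq_pexp2l ?orbT //; apply: wt_le.
by apply: sub_all bK => z /leq_trans; apply; rewrite leq_addl.
Qed.

(** Every element has weight at least 1, so an element of [S] costs O(n^(c-1)) and [n] of them cost
    O(n^c). *)
Lemma nf_word_bound (S : seq G) : 0 < c ->
  (forall g, malcev_sub x 0 g) -> (forall g, I 1 g) ->
  exists K, forall n (v : seq G), 0 < n -> size v <= n -> {subset v <= S} ->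
  exists a, [/\ size a = r, \prod_(g <- v) g = nf x a &
    all (fun z : int => `|z| <= K * n ^ c)%N a].
Proof.
move=> c0 G0 I1.
have [K HK] : exists K, forall g, g \in S -> forall n, 0 < n -> costs 0 n g (K * n ^ (c - 1)).
  elim: S => [|h S [K IHS]]; first by exists 0.
  have [|K' HK'] := costs_filtration _ (G0 h) (I1 h); first by rewrite c0.
  exists (K + K')%N => g; rewrite in_cons => /orP[/eqP-> n n0|gS n n0].
    by apply: costs_le (HK' n n0); rewrite leq_mul2r leq_addl orbT.
  by apply: costs_le (IHS g gS n n0); rewrite leq_mul2r leq_addr orbT.
have [K' HK'] := @nf_bound 0 K (leq0n _).
exists K' => n v n0 vn vS.
have [W Wi [Wv cW]] : costs 0 n (\prod_(g <- v) g) (size v * (K * n ^ (c - 1))).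
  elim: v vS {vn} => [|g v IHv] vS; first by rewrite big_nil; apply: costs1.
  rewrite big_cons /= mulSn; apply: costsM.
    by apply: HK => //; apply: vS; rewrite mem_head.
  by apply: IHv => h hv; apply: vS; rewrite in_cons hv orbT.
have [|a] := HK' n W n0 Wi.
  apply: leq_trans cW _; rewrite mulnCA leq_mul2l; apply/orP; right.
  by rewrite -{2}(subnKC c0) expnD expn1 leq_mul2r vn orbT.
by rewrite drop0 subn0 Wv; exists a.
Qed.

End CollectionProcess.

(** * Coordinates with respect to a Mal'cev basis of the group *)

Section MalcevCoordinates.
Variables (G : groupType) (c : nat) (x : seq G) (t : nat -> G -> int).
Local Open Scope group_scope.
Local Notation r := (size x).
Hypothesis c_gt0 : 0 < c.
Hypothesis lcs_trivial : trivial_sub (@lcs G c).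
Hypothesis G_torsion_free : torsion_free G.
Hypothesis x_basis : malcev_basis_lcs c x.
Hypothesis t_coords : malcev_coords x t.

Lemma basis_icf : infinite_cyclic_factors x.
Proof. by case: x_basis. Qed.

Lemma coords_nf a i : size a = r -> i < r -> t i (nf x a) = nth 0%R a i.
Proof.
move=> sa ir; have /(nf_inj basis_icf) : nf x (mkseq (fun i => t i (nf x a)) r) = nf x a.
  by rewrite -t_coords.
by rewrite size_mkseq sa => /(_ erefl erefl) E; rewrite -[in RHS]E nth_mkseq.
Qed.

Lemma coords_inj g h : (forall i, i < r -> t i g = t i h) -> g = h.
Proof.
move=> E; rewrite (t_coords g) (t_coords h); congr (nf x _).
apply: (@eq_from_nth _ 0%R); rewrite ?size_mkseq // => i ir.
by rewrite !nth_mkseq // E.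
Qed.

Lemma iso_lcs_trivial s (g : G) : c < s -> iso_lcs s g -> g = 1.
Proof.
move=> cs [n gn]; apply: (@G_torsion_free g n); apply: lcs_trivial.
by apply: lcs_le gn; lia.
Qed.

(** Closure under products is read off the Mal'cev basis, whose tails are the isolators up to
    [c.+1]; beyond that the isolators are trivial. *)
Lemma iso_lcs_subgroup s : 0 < s -> subgroup (@iso_lcs G s).
Proof.
move=> s0; have [sc|cs] := leqP s c.+1.
  have [_ _ /(_ s)] := x_basis; rewrite s0 sc => /(_ isT)[i [_ E]].
  have [N1 NM NV] := malcev_sub_subgroup x i.
  split; first exact/E.
  - by move=> g h /E Ng /E Nh; apply/E; apply: NM.
  - by move=> g /E Ng; apply/E; apply: NV.
have one (g : G) : iso_lcs s g -> g = 1 by apply: iso_lcs_trivial; lia.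
have I1 : @iso_lcs G s 1.
  by exists 0; rewrite expg1; case: (lcs_normal G s.-1) => -[].
by split=> // [g h /one-> /one->|g /one->]; rewrite ?mulg1 ?invg1.
Qed.

Lemma malcev_sub0 g : malcev_sub x 0 g.
Proof. by rewrite (t_coords g) -{2}(drop0 x); apply: malcev_sub_nf. Qed.

Lemma coords_word_bound (S : seq G) :
  exists K, forall n (v : seq G), 0 < n -> size v <= n -> {subset v <= S} ->
  forall i, i < r -> (`|t i (\prod_(g <- v) g)| <= K * n ^ c)%N.
Proof.
have [x_normal _ x_iso] := x_basis.
pose P j i := 0 < j -> forall g, malcev_sub x i g <-> iso_lcs j g.
have [j jc|m0 m0P] := @finite_choice P c.+2.
  case: j jc => [|j] jc; first by exists 0.
  by have [//|i [_ E]] := x_iso j.+1; exists i.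
(* [m j] is the index at which the isolator of [Gamma j] starts; forcing [m 1 = 0] gives every index
   weight at least 1. *)
pose m (j : nat) := if j == 1%N then 0 else m0 j.
have iso1 (g : G) : iso_lcs 1 g by exists 0.
have mP j g : 0 < j <= c -> malcev_sub x (m j) g <-> iso_lcs j g.
  move=> /andP[j0 jc]; rewrite /m; case: eqP => [->|_].
    by split=> _; [apply: iso1 | apply: malcev_sub0].
  by apply: m0P => //; lia.
pose wt k := \max_(j < c.+1 | m j <= k) j.
have wt_ge j k : j <= c -> m j <= k -> j <= wt k.
  move=> jc mk; rewrite /wt.
  by apply: (@leq_bigmax_cond _ (fun i : 'I_c.+1 => m i <= k) val (Ordinal (jc : j < c.+1))).
have wt_gt0 k : 0 < wt k by apply: wt_ge.
have wt_le k : wt k <= c by apply/bigmax_leqP => j _; rewrite -ltnS.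
have wt_iso k : k < r -> iso_lcs (wt k) (nth 1 x k).
  move=> kr; have : 0 < #|[pred j : 'I_c.+1 | m j <= k]|.
    by apply/card_gt0P; exists (Ordinal (c_gt0 : 1 < c.+1)).
  case/(eq_bigmax_cond val) => j mk E.
  have wtE : wt k = j by rewrite /wt -E.
  rewrite wtE; apply/mP; first by rewrite -wtE wt_gt0 wt_le.
  by apply: malcev_sub_nth; rewrite kr andbT; exact: mk.
have iso_word i s g : 0 < s <= c -> malcev_sub x i g -> iso_lcs s g ->
    exists2 W, wrange x i W & wval x W = g /\ all (fun l => s <= wt l.2) W.
  move=> sc gi /(mP _ _ sc) gs; have /andP[_ sc'] := sc.
  (* Both subgroups containing [g] are tails of the same basis, so [g] is spelled in the smaller
     one. *)
  have [mi|im] := leqP (m s) i.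
    have [W Wi Wg] := malcev_sub_word gi; exists W => //; split=> //.
    by apply: sub_all Wi => l /andP[il _]; apply: wt_ge => //; apply: leq_trans il.
  have [W Wi Wg] := malcev_sub_word gs; exists W.
    by apply: wrange_le Wi; apply: ltnW.
  split=> //; by apply: sub_all Wi => l /andP[il _]; apply: wt_ge.
have [] := @nf_word_bound G x c wt (@iso_lcs G) x_normal _ _ wt_iso iso_lcs_subgroup
  _ iso_lcs_trivial iso_word S c_gt0 malcev_sub0 iso1.
- by [].
- by [].
- move=> a b g h a0 b0; apply: (iso_lcs_comm lcs_trivial) => //.
  by apply: iso_lcs_subgroup; rewrite addn_gt0 a0.
move=> K HK; exists K => n v n0 vn vS i ir.
have [a [sa -> aK]] := HK n v n0 vn vS.
by rewrite coords_nf //; apply: (allP aK); apply: mem_nth; rewrite sa.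
Qed.

Lemma nf_mul_central (xs : seq G) a i z u : size a = size xs -> i < size xs ->
  z = expgz (nth 1 xs i) u -> (forall g, commute g z) ->
  nf xs a * z = nf xs (set_nth 0%R a i (nth 0%R a i + u)%R).
Proof.
elim: xs a i => [|y xs IHxs] [|e a] //= [|i] [sa] ir zE cz /=.
  by rewrite expgzD -zE -mulgA [nf xs a * z]cz mulgA.
by rewrite -mulgA (IHxs a i).
Qed.

(** A central power of a basis element slides to its own place in the normal form. This is the
    source of the constant shifts of the coordinates. *)
Lemma coords_mul_central i z u g j : i < r -> z = expgz (nth 1 x i) u ->
  (forall g, commute g z) -> j < r ->
  t j (g * z) = (t j g + (if j == i then u else 0))%R.
Proof.
move=> ir zE cz jr; rewrite {1}(t_coords g).
rewrite (@nf_mul_central _ _ i z u) ?size_mkseq // coords_nf //; last first.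
  by rewrite size_set_nth size_mkseq; apply/maxn_idPr.
rewrite nth_set_nth /= eq_sym; case: eqP => [->|_]; rewrite nth_mkseq ?addr0 //.
Qed.

End MalcevCoordinates.

(** * Word lengths in the unitriangular group *)

Section Unitriangular.
Variables (d : nat) (S : seq 'M[int]_d).
Local Open Scope ring_scope.

Lemma word_dist_leM A B p q :
  word_dist_le S A p -> word_dist_le S B q -> word_dist_le S (A *m B) (p + q).
Proof.
move=> [v [vS vp <-]] [w [wS wq <-]]; exists (v ++ w); split.
- by rewrite /word_over all_cat [all _ v]vS.
- by rewrite size_cat leq_add.
elim: v {vS vp} => [|l v IHv] /=; first by rewrite mul1mx.
by rewrite IHv mulmxA.
Qed.

Lemma word_dist_le1 n : word_dist_le S 1%:M n.
Proof. by exists [::]. Qed.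

Definition elem_mx (k l : 'I_d) (v : int) : 'M[int]_d := 1%:M + v *: delta_mx k l.

Lemma elem_mx_unitriangular (k l : 'I_d) v : (k < l)%N -> unitriangular (elem_mx k l v).
Proof.
move=> kl i j; rewrite !mxE eqxx; split=> [ji|].
  have -> : (i == j) = false by apply/eqP => E; move: ji; rewrite E ltnn.
  case: eqP => [ik|_]; case: eqP => [jl|_] //=; rewrite ?mulr0 ?addr0 //.
  by move: ji; rewrite ik jl; lia.
case: eqP => [ik|_]; case: eqP => [E|_] //=; rewrite ?mulr0 ?addr0 //.
by move: kl; rewrite -ik -E ltnn.
Qed.

Lemma elem_mxD (k l : 'I_d) u v : k != l ->
  elem_mx k l u *m elem_mx k l v = elem_mx k l (u + v).
Proof.
move=> kl; rewrite /elem_mx mulmxDl mul1mx mulmxDr mulmx1.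
rewrite -scalemxAl -scalemxAr mul_delta_mx_cond eq_sym (negPf kl) mulr0n !scaler0 addr0.
by rewrite -addrA -scalerDl [v + u]addrC.
Qed.

(** A commutator whose inverses are written by negating the parameters. *)
Lemma elem_mx_comm (k j l : 'I_d) u v : k != j -> j != l -> k != l ->
  elem_mx k j u *m elem_mx j l v *m (elem_mx k j (- u) *m elem_mx j l (- v)) =
  elem_mx k l (u * v).
Proof.
move=> kj jl kl; rewrite /elem_mx.
have key a b : (1%:M + a *: delta_mx k j) *m (1%:M + b *: delta_mx j l) =
    1%:M + (a *: delta_mx k j + b *: delta_mx j l + (a * b) *: delta_mx k l) :> 'M[int]_d.
  rewrite mulmxDl mul1mx mulmxDr mulmx1 -scalemxAl -scalemxAr mul_delta_mx scalerA.
  by rewrite -!addrA; congr (_ + _); rewrite addrCA.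
rewrite !key mulmxDl mul1mx mulmxDr mulmx1.
have [jk lj lk] : [/\ j != k, l != j & l != k] by rewrite ![_ == k]eq_sym [l == j]eq_sym.
rewrite !mulmxDl !mulmxDr -!scalemxAl -!scalemxAr mul_delta_mx !mul_delta_mx_0 //.
rewrite !scaler0 ?addr0 ?add0r.
rewrite !scalerA !scaleNr mulrNN mulrN scaleNr.
by apply/matrixP => a b; rewrite !mxE; ring.
Qed.

Hypothesis S_gen : generates (@unitriangular d) S.

Lemma elem_mx_dist1 (k l : 'I_d) v : (k < l)%N ->
  exists D, forall m : nat, word_dist_le S (elem_mx k l (v * m%:Z)) (D * m).
Proof.
move=> kl; have [_ /(_ _ (elem_mx_unitriangular v kl))[w [wS wE]]] := S_gen.
exists (size w); elim=> [|m IHm].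
  by rewrite mulr0 /elem_mx scale0r addr0; apply: word_dist_le1.
have -> : v * m.+1%:Z = v + v * m%:Z by rewrite intS mulrDr mulr1.
rewrite -elem_mxD ?mulnS; last by apply/eqP => E; move: kl; rewrite E ltnn.
by apply: word_dist_leM IHm; exists w.
Qed.

(* E_kl(v m^(p+1)) is an iterated commutator of E_(k,k+1)(m), E_(k+1,k+2)(m), ... *)
Lemma elem_mx_dist p (k l : 'I_d) v : (k + p < l)%N ->
  exists D, forall m : nat, word_dist_le S (elem_mx k l (v * m%:Z ^+ p.+1)) (D * m).
Proof.
elim: p k v => [|p IHp] k v kl; first by apply: elem_mx_dist1; rewrite addn0 in kl.
have jd : (k.+1 < d)%N by have := ltn_ord l; lia.
pose j := Ordinal jd.
have kj : (k < j)%N by [].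
have [D1 H1] := elem_mx_dist1 1 kj; have [D2 H2] := elem_mx_dist1 (-1) kj.
have jl : (j + p < l)%N by rewrite /=; lia.
have [D3 H3] := IHp j v jl; have [D4 H4] := IHp j (- v) jl.
exists (D1 + D3 + (D2 + D4))%N => m; rewrite !mulnDl.
have -> : v * m%:Z ^+ p.+2 = m%:Z * (v * m%:Z ^+ p.+1) by rewrite [_ ^+ p.+2]exprS mulrCA.
rewrite -(@elem_mx_comm k j l); first last.
- by apply/eqP => /(congr1 val) /=; lia.
- by apply/eqP => /(congr1 val) /=; lia.
- by apply/eqP => /(congr1 val) /=; lia.
apply: word_dist_leM; apply: word_dist_leM.
- by rewrite -[m%:Z]mul1r; apply: H1.
- exact: H3.
- by rewrite -mulN1r; apply: H2.
- by rewrite -mulNr; apply: H4.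
Qed.

(** The vanishing products of entries remove all cross terms, so the matrix is the product of its
    elementary factors, each of linear length by [elem_mx_dist]. *)
Lemma square_zero_dist p (A : 'M[int]_d) :
  (forall k l, A k l != 0 -> (k + p < l)%N) ->
  (forall k l m, A k l * A l m = 0) ->
  exists D, forall m : nat, word_dist_le S (1%:M + m%:Z ^+ p.+1 *: A) (D * m).
Proof.
move=> A_deg A_sq.
have -> : A = \sum_(ij : 'I_d * 'I_d) A ij.1 ij.2 *: delta_mx ij.1 ij.2.
  by rewrite {1}[A]matrix_sum_delta pair_big.
elim: (index_enum _) => [|[k l] s [D IHs]].
  by exists 0 => m; rewrite big_nil scaler0 addr0; apply: word_dist_le1.
have [D' HD'] : exists D, forall m : nat,
    word_dist_le S (elem_mx k l (A k l * m%:Z ^+ p.+1)) (D * m).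
  have [A0|/A_deg kl] := eqVneq (A k l) 0; last exact: elem_mx_dist.
  by exists 0 => m; rewrite A0 mul0r /elem_mx scale0r addr0; apply: word_dist_le1.
exists (D' + D)%N => m; rewrite mulnDl big_cons /=.
set B := \sum_(i <- s) _ in IHs *.
have -> : 1%:M + m%:Z ^+ p.+1 *: (A k l *: delta_mx k l + B) =
   elem_mx k l (A k l * m%:Z ^+ p.+1) *m (1%:M + m%:Z ^+ p.+1 *: B).
  rewrite /elem_mx mulmxDl mul1mx mulmxDr mulmx1 -!scalemxAl -scalemxAr.
  have -> : (A k l * m%:Z ^+ p.+1) *: (m%:Z ^+ p.+1 *: (delta_mx k l *m B)) = 0.
    rewrite /B mulmx_sumr !scaler_sumr big1 // => -[i j] _ /=.
    rewrite -scalemxAr mul_delta_mx_cond; case: eqP => [<-|_]; last by rewrite mulr0n !scaler0.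
    rewrite mulr1n !scalerA.
    rewrite [X in X *: _](_ : _ = A k l * A l j * (m%:Z ^+ p.+1) ^+ 2); last by ring.
    by rewrite A_sq mul0r scale0r.
  by rewrite addr0 scalerDr scalerA [A k l * _]mulrC -addrA [_ *: B + _]addrC.
by apply: word_dist_leM.
Qed.

End Unitriangular.

(** * Functions shifted by a constant under translation *)

Section Shift.
Variable G : groupType.
Local Open Scope ring_scope.

Definition shift (f : G -> rat) (z : G) (mu : rat) : Prop :=
  forall y, f (y * z)%g = f y + mu.

Lemma shiftM f z z' mu mu' :
  shift f z mu -> shift f z' mu' -> shift f (z * z')%g (mu + mu').
Proof. by move=> sz sz' y; rewrite mulgA sz' sz addrA. Qed.

Lemma shiftV f z mu : shift f z mu -> shift f z^-1%g (- mu).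
Proof. by move=> sz y; rewrite -{2}[y](mulgVK z) sz addrK. Qed.

Lemma shift_expgz f z mu (n : int) : shift f z mu -> shift f (expgz z n) (n%:~R * mu).
Proof.
move=> sz.
have shiftX (k : nat) : shift f (z ^+ k)%g (k%:~R * mu).
  elim: k => [|k IHk]; first by move=> y; rewrite mul0r addr0 expg0 mulg1.
  by rewrite expgSr intS addrC intrD mulrDl mul1r; apply: shiftM.
case: n => n; first exact: shiftX.
by rewrite NegzE intrN mulNr; apply/shiftV/shiftX.
Qed.

End Shift.

(** * Central elements and the rank of the last lower central term *)

Section CentralElements.
Variables (G : groupType) (c : nat).
Local Open Scope group_scope.

Lemma lcs_central z g : 0 < c -> trivial_sub (@lcs G c) -> @lcs G c.-1 z -> commute g z.
Proof.
move=> c0 tc zc; apply/commute_sym/commgP/eqP/tc.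
by rewrite -(prednK c0); apply: lcs_comm.
Qed.

Lemma nf_nseq0 (xs : seq G) n : nf xs (nseq n 0%R) = 1.
Proof. by elim: xs n => [|y xs IHxs] [|n] //=; rewrite IHxs mulg1. Qed.

(** Otherwise the isolator would be cyclic, and two free generators [y1], [y2] would be powers of
    one element with exponents [a1], [a2]. *)
Lemma malcev_rank_ge2 (x : seq G) i r :
  (forall g, malcev_sub x i g <-> isolator (@Gamma G c) g) ->
  2 <= r -> free_abelian_of_rank (@Gamma G c) r -> i.+1 < size x.
Proof.
move=> iso r2 [ys [sy [ysP [uniq_nf nfP]]]]; rewrite ltnNge; apply/negP => xi.
have cyclic g : Gamma c g -> exists e, g = expgz (nth 1 x i) e.
  move=> gc; have : malcev_sub x i g by apply/iso; exists 0; rewrite expg1.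
  apply: (@gen_min _ _ (fun g => exists e, g = expgz (nth 1 x i) e)).
    split; first by exists 0%R.
    - by move=> _ _ [a ->] [b ->]; exists (a + b)%R; rewrite expgzD.
    - by move=> _ [a ->]; exists (- a)%R; rewrite expgzN.
  move=> h [j [/andP[ij jx] ->]]; exists 1%R => /=.
  by rewrite expg1; congr (nth 1 x _); lia.
case: ys sy ysP uniq_nf nfP => [|y1 [|y2 ys]] sy ysP uniq_nf nfP; try by move: r2; rewrite -sy.
have zero_uniq a : size a = r -> nf [:: y1, y2 & ys] a = 1 -> a = nseq r 0%R.
  move=> sa a1; have G1 : Gamma c (1 : G) by case: (lcs_normal G c.-1) => -[].
  have [b [_ ub]] := uniq_nf 1 G1.
  rewrite -(ub a) // -(ub (nseq r 0%R)) //.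
  by split; [rewrite size_nseq | rewrite nf_nseq0].
have [a1 E1] := cyclic y1 (ysP _ (mem_head _ _)).
have [|a2 E2] := cyclic y2; first by apply: ysP; rewrite !in_cons eqxx orbT.
have r_eq : r = (size ys).+2 by rewrite -sy.
(* The relation between [y1 ^ a2] and [y2 ^ a1] must be trivial, so [a1 = 0]; then [y1 = 1], which
   uniqueness of normal forms excludes. *)
have a10 : a1 = 0%R.
  have := zero_uniq [:: a2, (- a1)%R & nseq (size ys) 0%R].
  rewrite /= size_nseq r_eq nf_nseq0 mulg1 {1}E1 {1}E2 -!expgzM -expgzD.
  rewrite mulrN [(a2 * a1)%R]mulrC subrr /= => /(_ erefl erefl) [_ /eqP].
  by rewrite oppr_eq0 => /eqP.
have := zero_uniq [:: 1%R, 0%R & nseq (size ys) 0%R].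
by rewrite /= size_nseq r_eq nf_nseq0 !mulg1 expg1 E1 a10 /= => /(_ erefl erefl) [].
Qed.

End CentralElements.

(** * The Nickel representation *)

Section Nickel.
Variables (G : groupType) (x : seq G) (t : nat -> G -> int) (d : nat).
Variables (b : 'I_d -> G -> rat) (phi : G -> 'M[int]_d).
Local Open Scope ring_scope.
Local Notation r := (size x).
Hypothesis t_coords : malcev_coords x t.
Hypothesis phi_nickel : nickel_embedding x t b phi.

Local Notation tq i := (fun g => (t i g)%:~R : rat).

Lemma nickel_act g k y : b k (y * g^-1)%g = \sum_l (phi g k l)%:~R * b l y.
Proof. by case: phi_nickel => _ _ _ act _; apply: act. Qed.

Lemma nickel_unitriangular g : unitriangular (phi g).
Proof. by case: phi_nickel. Qed.

Lemma nickel_uniq (u v : 'I_d -> rat) :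
  (forall y, \sum_l u l * b l y = \sum_l v l * b l y) -> forall l, u l = v l.
Proof.
move=> E l; have [_ _ indep _ _] := phi_nickel.
apply/eqP; rewrite -subr_eq0; apply/eqP.
apply: (indep (fun l => u l - v l)) => y.
under eq_bigr do rewrite mulrBl.
by rewrite sumrB E subrr.
Qed.

Lemma nickelM g h : phi (g * h)%g = phi g *m phi h.
Proof.
apply/matrixP => k l; apply: (@intr_inj rat); move: l; apply: nickel_uniq => y.
rewrite -nickel_act invgM mulgA nickel_act.
under eq_bigr do rewrite nickel_act mulr_sumr.
rewrite exchange_big /=; apply: eq_bigr => l _.
rewrite mxE rmorph_sum mulr_suml; apply: eq_bigr => j _.
by rewrite /= intrM mulrA.
Qed.

Lemma nickel1 : phi 1%g = 1%:M.
Proof.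
apply/matrixP => k l; apply: (@intr_inj rat); move: l; apply: nickel_uniq => y.
rewrite -nickel_act invg1 mulg1 (bigD1 k) //= mxE eqxx mul1r big1 ?addr0 // => l lk.
by rewrite mxE eq_sym (negPf lk) mul0r.
Qed.

Lemma nickelV g : phi g^-1%g = invmx (phi g).
Proof.
have E : phi g *m phi g^-1%g = 1%:M by rewrite -nickelM mulgV nickel1.
have [u _] := mulmx1_unit E.
by rewrite -[LHS](mulKmx u) E mulmx1.
Qed.

Lemma in_nickel_t i : (i < r)%N -> in_nickel_module x t (tq i).
Proof.
move=> ir; exists [:: (1, 1%g, i)]; rewrite /= ir; split=> // h.
by rewrite big_seq1 /= mul1r /dual_act invg1 mulg1.
Qed.

(** The matrix of [g] determines the values of the module functions at [g^-1], in particular its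
    coordinates. *)
Lemma nickel_inj : injective phi.
Proof.
move=> g h E; apply: invg_inj; apply: (coords_inj t_coords) => i ir.
have [_ /(_ _ (in_nickel_t ir))[cf cfE] _ _ _] := phi_nickel.
apply: (@intr_inj rat); rewrite !cfE; apply: eq_bigr => l _.
by rewrite -[g^-1%g]mul1g -[h^-1%g]mul1g !nickel_act E.
Qed.

Definition upper_deg (s : nat) (A : 'M[int]_d) : Prop :=
  forall k l : 'I_d, (l < k + s)%N -> A k l = 0.

Lemma upper_degM s s' A B :
  upper_deg s A -> upper_deg s' B -> upper_deg (s + s') (A *m B).
Proof.
move=> As Bs k l kl; rewrite mxE big1 // => j _.
have [jk|kj] := ltnP j (k + s); first by rewrite As ?mul0r.
by rewrite Bs ?mulr0 //; lia.
Qed.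

Lemma upper_degD s A B : upper_deg s A -> upper_deg s B -> upper_deg s (A + B).
Proof. by move=> As Bs k l kl; rewrite mxE As ?Bs ?addr0. Qed.

Lemma upper_degN s A : upper_deg s A -> upper_deg s (- A).
Proof. by move=> As k l kl; rewrite mxE As ?oppr0. Qed.

Lemma nickel_deg0 g : upper_deg 0 (phi g).
Proof. by move=> k l; rewrite addn0; case: (nickel_unitriangular g k l). Qed.

Lemma nickel_deg1 g : upper_deg 1 (phi g - 1%:M).
Proof.
move=> k l; rewrite addn1 ltnS leq_eqVlt => /orP[/eqP kl|lk].
  have <- : l = k by apply: val_inj.
  by rewrite !mxE eqxx; case: (nickel_unitriangular g l l) => _ ->; rewrite subrr.
rewrite !mxE nickel_deg0 ?addn0 //; case: eqP => [E|_]; last by rewrite subr0.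
by move: lk; rewrite E ltnn.
Qed.

(** With [X = phi u - 1] and [Y = phi v - 1], the matrix [phi [~ u, v] - 1] is an upper triangular
    matrix times [X Y - Y X], and degrees add in products. *)
Lemma nickel_lcs_deg k g : lcs k g -> upper_deg k.+1 (phi g - 1%:M).
Proof.
elim: k g => [|k IHk] g; first by move=> _; apply: nickel_deg1.
elim=> {g} [g [u [v [uk ->]]]||g h _ Dg _ Dh|g _ Dg].
- set X := phi u - 1%:M; set Y := phi v - 1%:M.
  have -> : phi [~ u, v]%g - 1%:M = phi (u^-1 * v^-1)%g *m (X *m Y - Y *m X).
    have -> : X *m Y - Y *m X = phi (u * v)%g - phi (v * u)%g.
      rewrite /X /Y !nickelM !(mulmxBl, mulmxBr) !mulmx1 !mul1mx.
      by apply/matrixP => i j; rewrite !mxE; ring.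
    rewrite mulmxBr -!nickelM; congr (phi _ - _); first by rewrite /commg /conjg !mulgA.
    by rewrite -nickel1; congr phi; rewrite !mulgA mulgVK mulVg.
  rewrite -[k.+2]add0n; apply: upper_degM; first exact: nickel_deg0.
  apply: upper_degD; last apply: upper_degN.
    by rewrite -addn1; apply: upper_degM; [exact: IHk | exact: nickel_deg1].
  by rewrite -add1n; apply: upper_degM; [exact: nickel_deg1 | exact: IHk].
- by move=> i j _; rewrite nickel1 subrr mxE.
- have -> : phi (g * h)%g - 1%:M = phi g *m (phi h - 1%:M) + (phi g - 1%:M).
    by rewrite nickelM mulmxBr mulmx1 addrA subrK.
  by apply: upper_degD => //; apply: (upper_degM (nickel_deg0 g)).
have -> : phi g^-1%g - 1%:M = - (phi g^-1%g *m (phi g - 1%:M)).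
  by rewrite mulmxBr -nickelM mulVg nickel1 mulmx1 opprB.
by apply: upper_degN; apply: (upper_degM (nickel_deg0 _)).
Qed.

(** Module elements are combinations of translates of the [t_i]; a central [z] passes through the
    translation. Evaluation at 1 identifies the constant. *)
Lemma nickel_shift z : (forall g, commute g z) ->
  (forall i, (i < r)%N -> exists mu, shift (tq i) z mu) ->
  forall k, shift (b k) z (b k z - b k 1%g).
Proof.
move=> cz tz k; have [/(_ k)[l [lr bE]] _ _ _ _] := phi_nickel.
suff [mu E] : exists mu, forall y,
    \sum_(p <- l) p.1.1 * dual_act p.1.2 (tq p.2) (y * z)%g =
    \sum_(p <- l) p.1.1 * dual_act p.1.2 (tq p.2) y + mu.
  by move=> y; rewrite -{2}[z]mul1g !bE !E addrAC subrr add0r.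
elim: l lr {bE} => [|p l IHl] /=; first by exists 0 => y; rewrite !big_nil addr0.
move=> /andP[/tz[mu smu] /IHl[nu E]]; exists (p.1.1 * mu + nu) => y.
rewrite !big_cons E /dual_act -mulgA -[(z * _)%g]cz mulgA smu.
by ring.
Qed.

(** The action of [z] subtracts the constant function [mu k] from [b k]; the sign comes from the
    inverse in [dual_act]. *)
Lemma nickel_shift_mx (e : 'I_d -> rat) z mu : (forall y, \sum_l e l * b l y = 1) ->
  (forall k, shift (b k) z (mu k)) ->
  forall k l, (phi z k l - 1%:M k l)%:~R = - mu k * e l :> rat.
Proof.
move=> e1 sz k l; move: l; apply: nickel_uniq => y.
under eq_bigr do rewrite intrB mulrBl.
rewrite sumrB -nickel_act; under [in RHS]eq_bigr do rewrite -mulrA.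
rewrite -[in RHS]mulr_sumr e1 mulr1 (shiftV (sz k)) (bigD1 k) //= mxE eqxx mul1r.
rewrite big1; first by rewrite addr0 addrAC subrr add0r.
by move=> l lk; rewrite mxE eq_sym (negPf lk) mul0r.
Qed.

(** The constant 1 is the difference of a translate of [t_i] and [t_i] itself, divided by [mu]. *)
Lemma nickel_const z i mu : (i < r)%N -> mu != 0 -> shift (tq i) z mu ->
  exists e : 'I_d -> rat, forall y, \sum_l e l * b l y = 1.
Proof.
move=> ir mu0 sz; have [_ spans _ _ _] := phi_nickel.
have [|e eE] := spans (fun=> 1); last by exists e => y; rewrite -eE.
exists [:: (mu^-1, z^-1%g, i); (- mu^-1, 1%g, i)]; rewrite /= ir; split=> // h.
rewrite big_cons big_seq1 /= /dual_act invgK invg1 mulg1 sz mulNr -mulrBr.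
by rewrite addrAC subrr add0r mulVf.
Qed.

(** [S] contains preimages of the generators and their inverses, so signed matrix words lift to
    plain products, the form needed by [coords_word_bound]. *)
Lemma nickel_words (SH : seq 'M[int]_d) : (forall s, s \in SH -> image_of phi s) ->
  exists S : seq G, forall w, word_over SH w -> exists v : seq G,
    [/\ size v = size w, {subset v <= S} & phi (\prod_(g <- v) g)%g = eval_word w].
Proof.
move=> imSH.
have [S HS] : exists S : seq G, forall s, s \in SH ->
    exists g, [/\ s = phi g, g \in S & g^-1%g \in S].
  elim: SH imSH => [|s SH IHSH] im; first by exists [::].
  have [|S HS] := IHSH; first by move=> u uS; apply: im; rewrite in_cons uS orbT.
  have [g sg] := im s (mem_head _ _).
  exists [:: g, g^-1%g & S] => u; rewrite in_cons => /orP[/eqP->|/HS[h [-> h1 h2]]].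
    by exists g; rewrite sg !in_cons !eqxx orbT.
  by exists h; rewrite !in_cons h1 h2 !orbT.
exists S; elim=> [|[e s] w IHw] /=.
  by exists [::]; rewrite big_nil nickel1.
move=> /andP[/HS[g [sg gS gVS]] /IHw[v [sv vS vE]]].
exists ((if e then g^-1%g else g) :: v); split; first by rewrite /= sv.
  by move=> h; rewrite in_cons => /orP[/eqP->|/vS//]; case: (e).
rewrite big_cons nickelM vE /= sg; congr (_ *m _).
by case: (e); rewrite ?nickelV.
Qed.

End Nickel.

(* If l0 is the first index with e l0 <> 0, then (l0 - c, l0) is the only
   position on the c-th superdiagonal where a matrix mu (x) e can be nonzero. *)
Lemma rank_one_combination (d c : nat) (e mu1 mu2 : 'I_d -> rat) (A1 A2 : 'M[int]_d) :
  (forall k l, (A1 k l)%:~R = mu1 k * e l)%R ->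
  (forall k l, (A2 k l)%:~R = mu2 k * e l)%R ->
  upper_deg c A1 -> upper_deg c A2 -> (exists l, e l != 0%R) ->
  exists u v : int, (u != 0%R) || (v != 0%R) /\
    forall k l : 'I_d, l <= k + c -> ((u%:~R * mu1 k + v%:~R * mu2 k) * e l = 0)%R.
Proof.
move=> E1 E2 D1 D2 [l1 el1].
have [l0 el0 l0_min] : exists2 l0 : 'I_d, e l0 != 0%R &
    forall l : 'I_d, l < l0 -> e l = 0%R.
  case: (@arg_minnP _ l1 (fun l => e l != 0%R) val el1) => l0 el0 min0.
  exists l0 => // l ll0; apply/eqP; apply: contraLR ll0 => /min0.
  by rewrite -leqNgt.
(* When [k + c > l0], the entry at [(k, l0)] vanishes by degree while [e l0] does not. *)
have late (mu : 'I_d -> rat) (A : 'M[int]_d) : (forall k l, (A k l)%:~R = mu k * e l)%R ->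
    upper_deg c A -> forall k : 'I_d, l0 < k + c -> mu k = 0%R.
  move=> E D k /D Akl; have := E k l0; rewrite Akl => /esym/eqP.
  by rewrite mulf_eq0 (negPf el0) orbF => /eqP.
have main u v : (forall k : 'I_d, k + c = l0 -> (u * A1 k l0 + v * A2 k l0 = 0)%R) ->
    forall k l : 'I_d, l <= k + c -> ((u%:~R * mu1 k + v%:~R * mu2 k) * e l = 0)%R.
  move=> uv k l lk.
  have [kl0|l0k] := ltnP l0 (k + c).
    by rewrite (late _ _ E1 D1) // (late _ _ E2 D2) // !mulr0 addr0 mul0r.
  have [ll0|l0l] := ltnP l l0; first by rewrite l0_min ?mulr0.
  have -> : l = l0 by apply: val_inj; rewrite /=; lia.
  rewrite mulrDl -!mulrA -E1 -E2 -!intrM -intrD uv //; lia.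
have [k0 /eqP k0c|no_k] := pickP (fun k : 'I_d => k + c == l0); last first.
  by exists 1%R, 0%R; split=> //; apply: main => k kc; have := no_k k; rewrite /= kc eqxx.
have uniq_k (k : 'I_d) : k + c = l0 -> k = k0 by move=> kc; apply: val_inj; rewrite /=; lia.
(* One linear condition on [(u, v)], coming from the single critical position, always has a nonzero
   integer solution. *)
have [A20|A20] := eqVneq (A2 k0 l0) 0%R; last first.
  exists (A2 k0 l0), (- A1 k0 l0)%R; split; first by rewrite A20.
  by apply: main => k /uniq_k ->; ring.
by exists 0%R, 1%R; split=> //; apply: main => k /uniq_k ->; rewrite A20; ring.
Qed.

(** * Comparison of the two length estimates *)

Theorem theorem4p7 (G : groupType) (c : nat) :
  tau_group G -> nil_class G c ->
  (exists r, (2 <= r)%N /\ free_abelian_of_rank (@Gamma G c) r) ->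
  forall (x : seq G) (t : nat -> G -> int),
    malcev_basis_lcs c x -> malcev_coords x t ->
  forall (d : nat) (b : 'I_d -> G -> rat) (phi : G -> 'M[int]_d),
    nickel_embedding x t b phi ->
    ~ undistorted (image_of phi) (@unitriangular d).
Proof.
move=> [_ tfG _ [g0 [h0 nab]]] [tc _] [r [r2 free_r]] x t x_basis t_coords d b phi nick.
move=> [SH [SK [[imSH _] [genK [C undist]]]]].
have c0 : 0 < c.
  by rewrite lt0n; apply/eqP => cE; apply: nab; rewrite cE in tc; rewrite (tc g0) // (tc h0).
have [_ _ /(_ c)] := x_basis; rewrite c0 leqnSn => /(_ isT)[i [_ iso_i]].
have i1r := malcev_rank_ge2 iso_i r2 free_r; have ir := ltnW i1r.
have [n1 z1c] : isolator (Gamma c) (nth 1%g x i).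
  by apply/iso_i; apply: malcev_sub_nth; rewrite leqnn.
have [n2 z2c] : isolator (Gamma c) (nth 1%g x i.+1).
  by apply/iso_i; apply: malcev_sub_nth; rewrite leqnSn.
(* Powers of two basis elements of the isolator, taken so as to land in [Gamma c], hence in the
   centre; they shift different coordinates. *)
set z1 := (nth 1%g x i ^+ n1.+1)%g in z1c; set z2 := (nth 1%g x i.+1 ^+ n2.+1)%g in z2c.
have cz1 g : commute g z1 by apply: (lcs_central g c0 tc z1c).
have cz2 g : commute g z2 by apply: (lcs_central g c0 tc z2c).
pose tq j g := ((t j g)%:~R : rat)%R.
have st1 j : j < size x -> shift (tq j) z1 (if j == i then n1.+1%:~R else 0)%R.
  move=> jr g; rewrite /tq.
  rewrite (coords_mul_central x_basis t_coords (u := Posz n1.+1) g ir) // intrD.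
  by case: eqP.
have st2 j : j < size x -> shift (tq j) z2 (if j == i.+1 then n2.+1%:~R else 0)%R.
  move=> jr g; rewrite /tq.
  rewrite (coords_mul_central x_basis t_coords (u := Posz n2.+1) g i1r) // intrD.
  by case: eqP.
have [e e1] : exists e : 'I_d -> rat, forall y, (\sum_l e l * b l y = 1)%R.
  by apply: (nickel_const nick ir _ (st1 i ir)); rewrite eqxx intr_eq0.
pose mu1 k := (b k z1 - b k 1%g)%R; pose mu2 k := (b k z2 - b k 1%g)%R.
have sb1 k : shift (b k) z1 (mu1 k).
  by apply: (nickel_shift nick cz1) => j jr; eexists; apply: st1.
have sb2 k : shift (b k) z2 (mu2 k).
  by apply: (nickel_shift nick cz2) => j jr; eexists; apply: st2.
have mx1 := nickel_shift_mx nick e1 sb1; have mx2 := nickel_shift_mx nick e1 sb2.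
have D1 := nickel_lcs_deg nick z1c; have D2 := nickel_lcs_deg nick z2c.
rewrite prednK // in D1 D2.
have [|||u [v [uv0 uv]]] := @rank_one_combination d c e (fun k => - mu1 k)%R (fun k => - mu2 k)%R
  (phi z1 - 1%:M)%R (phi z2 - 1%:M)%R _ _ D1 D2.
- by move=> k l; rewrite -mx1 !mxE.
- by move=> k l; rewrite -mx2 !mxE.
- apply/existsP; apply: contraT; rewrite negb_exists => /forallP e0.
  have := e1 1%g; rewrite big1 => [/esym/eqP|l _]; first by rewrite oner_eq0.
  by have := e0 l; rewrite negbK => /eqP ->; rewrite mul0r.
pose z := (expgz z1 u * expgz z2 v)%g.
pose mu k := (u%:~R * mu1 k + v%:~R * mu2 k)%R.
have sb k : shift (b k) z (mu k) by apply: shiftM; apply: shift_expgz.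
have mu_e (k l : 'I_d) : l <= k + c -> (mu k * e l = 0)%R.
  by move=> /uv /eqP; rewrite !mulrN -opprD mulNr oppr_eq0 => /eqP.
(* The combination [z] still moves a coordinate: the [i]-th if [u] is nonzero, the next one if [v]
   is. *)
have [j jr [nu nu0 st]] : exists2 j, j < size x & exists2 nu : int, nu != 0%R &
    shift (tq j) z nu%:~R%R.
  have st j : j < size x -> shift (tq j) z
     (u%:~R * (if j == i then n1.+1%:~R else 0) + v%:~R * (if j == i.+1 then n2.+1%:~R else 0))%R.
    by move=> jr; apply: shiftM; apply: shift_expgz; [apply: st1 | apply: st2].
  case/orP: uv0 => [u0|v0].
    exists i => //; exists (u * n1.+1%:Z)%R; first by rewrite mulf_neq0.
    by have := st i ir; rewrite eqxx (ltn_eqF (ltnSn i)) mulr0 addr0 -intrM.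
  exists i.+1 => //; exists (v * n2.+1%:Z)%R; first by rewrite mulf_neq0.
  by have := st i.+1 i1r; rewrite eqxx (gtn_eqF (ltnSn i)) mulr0 add0r -intrM.
pose A := (phi z - 1%:M)%R.
have AE k l : ((A k l)%:~R = - mu k * e l :> rat)%R.
  by rewrite -(nickel_shift_mx nick e1 sb) !mxE.
have [k l|k l m|D distK] := @square_zero_dist d SK genK c A.
- apply: contraNltn => lk; rewrite -(intr_eq0 rat) AE mulNr mu_e ?oppr0 //.
(* The product contains the factor [mu l * e l], a diagonal position, which vanishes. *)
- apply/eqP; rewrite -(intr_eq0 rat) intrM !AE.
  rewrite mulrA -[(_ * e l * - _)%R]mulrA mulrN [(e l * _)%R]mulrC.
  by rewrite mu_e ?oppr0 ?mulr0 ?mul0r ?leq_addr.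
have [S HS] := nickel_words nick imSH.
have [K HK] := coords_word_bound c0 tc tfG x_basis t_coords S.
(* The lifted word has length at most [B * m], and [m] exceeds [2 * K * B ^ c], so [m ^ c.+1]
   exceeds [2 * K * (B * m) ^ c]. *)
pose B := (C * D).+1.
pose m := (2 * (K * B ^ c)).+1.
pose N := (m ^ c.+1)%N.
have phiN : phi (expgz z N) = (1%:M + m%:Z ^+ c.+1 *: A)%R.
  have NE : Posz N = (m%:Z ^+ c.+1)%R by rewrite -[Posz N]natz natrX natz.
  apply/matrixP => k l; apply: (@intr_inj rat).
  have := nickel_shift_mx nick e1 (fun k => shift_expgz N (sb k)) k l.
  rewrite intrB => /(canRL (subrK _)) ->.
  rewrite [in RHS]mxE [(_ *: A)%R k l]mxE intrD intrM AE -NE; ring.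
have [w [wSH wsize wE]] : word_dist_le SH (phi (expgz z N)) (C * (D * m)).
  by apply: undist; [exists (expgz z N) | rewrite phiN].
have [v' [sv' v'S v'E]] := HS w wSH.
have {v'E} zN : (\prod_(g <- v') g)%g = expgz z N.
  by apply: (nickel_inj t_coords nick); rewrite v'E.
have Bm0 : 0 < B * m by [].
have bound_z : (`|t j (expgz z N)| <= K * (B * m) ^ c)%N.
  rewrite -zN; apply: HK => //; rewrite sv'; apply: leq_trans wsize _.
  by rewrite mulnA leq_mul2r leqnSn orbT.
(* The coordinate of 1 is bounded through the empty word; this accounts for the factor 2 in [m]. *)
have bound_1 : (`|t j 1%g| <= K * (B * m) ^ c)%N.
  have := HK (B * m)%N [::] Bm0 isT; rewrite big_nil; exact.
have tzN : (t j (expgz z N) = t j 1%g + N%:Z * nu)%R.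
  apply: (@intr_inj rat); rewrite intrD intrM.
  by have := shift_expgz N st 1%g; rewrite mul1g.
have : (N <= 2 * (K * (B * m) ^ c))%N.
  have : (N <= `|(N%:Z * nu)%R|)%N by rewrite abszM leq_pmulr // absz_gt0.
  by move: tzN bound_z bound_1; move: (K * _)%N (t j _) (t j _) (_ * nu)%R; lia.
rewrite /N expnS expnMn !mulnA -[(2 * K * _)%N]mulnA leq_pmul2r ?expn_gt0 //.
by rewrite /m ltnn.
Qed.
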